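(* Let $S$ and $R$ be finite-dimensional real Hilbert spaces, with coordinate isomorphism $D_S : S \to \mathbb{R}^{N_S}$, $N_S=\dim S$, with respect to a fixed basis of $S$, and let $\underline{M}_S$ be the inner product (Gram) matrix of $S$ in that basis, with smallest eigenvalue $\lambda^{\underline{M}_S}_{\min}$. Let $O : S \to R$ be a linear operator, $n_t \ge 1$ an integer, and $\varepsilon_{\mathrm{testfail}} \in (0,1)$. Let $\underline{r}_1,\dots,\underline{r}_{n_t}$ be independent random normal vectors in $\mathbb{R}^{N_S}$ and define $$ \Delta(O,n_t,\varepsilon_{\mathrm{testfail}}) := c_{\mathrm{est}}(n_t,\varepsilon_{\mathrm{testfail}}) \max_{i=1,\dots,n_t} \|O D_S^{-1}\underline{r}_i\|_R, \qquad c_{\mathrm{est}}(n_t,\varepsilon_{\mathrm{testfail}}) := \frac{1}{\sqrt{2\lambda^{\underline{M}_S}_{\min}}\;\operatorname{erf}^{-1}\!\left(\sqrt[n_t]{\varepsilon_{\mathrm{testfail}}}\right)}. $$ Then $\Delta(O,n_t,\varepsilon_{\mathrm{testfail}})$ is an upper bound of the operator norm $\|O\|$ with probability greater than or equal to $1-\varepsilon_{\mathrm{testfail}}$, i.e. $$ P\big(\Delta(O,n_t,\varepsilon_{\mathrm{testfail}}) \ge \|O\|\big) \ge 1-\varepsilon_{\mathrm{testfail}}. $$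
   Context: A random normal vector in $\mathbb{R}^{N_S}$ is a vector whose entries are independent standard normal (mean $0$, variance $1$) random variables. The coordinate isomorphism $D_S$ maps an element of $S$ to the vector of its coefficients in the fixed basis, so that $(v,w)_S = (D_S v)^T\underline{M}_S(D_S w)$ for all $v,w\in S$. The operator norm is $\|O\| := \sup_{0\neq\xi\in S}\|O\xi\|_R/\|\xi\|_S$. Here $\operatorname{erf}(x)=\frac{2}{\sqrt{\pi}}\int_0^x e^{-t^2}\,dt$ is the error function and $\operatorname{erf}^{-1}$ its inverse. *)

(* Defs.v *)
From HB Require Import structures.
From mathcomp Require Import all_boot all_order all_algebra.
From mathcomp Require Import all_classical all_reals all_analysis.
Set Implicit Arguments.
Unset Strict Implicit.
Unset Printing Implicit Defensive.
Import Order.TTheory GRing.Theory Num.Theory.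
Import numFieldNormedType.Exports.
Local Open Scope classical_set_scope.
Local Open Scope ring_scope.

(* A finite-dimensional real Hilbert space is a [vectType] over a [realType]
   together with an inner product [{dot V for idfun}]: a symmetric, positive
   definite bilinear form (completeness is automatic). *)

Definition dot_norm (R : realType) (V : vectType R)
    (dot : {dot V for (idfun : R -> R)}) (v : V) : R :=
  Num.sqrt (dot v v).

(* The set is bounded since [V] is finite-dimensional; it is empty only if [V] is
   trivial, and then [sup] returns 0. *)
Definition op_norm (R : realType) (V W : vectType R)
    (dotV : {dot V for (idfun : R -> R)}) (dotW : {dot W for (idfun : R -> R)})
    (O : 'Hom(V, W)) : R :=
  sup [set dot_norm dotW (O xi) / dot_norm dotV xi | xi in [set xi | xi != 0]].

Definition gram_mx (R : realType) (V : vectType R)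
    (dot : {dot V for (idfun : R -> R)}) (e : (\dim {:V}).-tuple V) :
    'M[R]_(\dim {:V}) :=
  \matrix_(i, j) dot (tnth e i) (tnth e j).

(* The set of eigenvalues is finite, and nonempty for symmetric [M] with [n > 0],
   so the infimum is the minimum. *)
Definition lambda_min (R : realType) (n : nat) (M : 'M[R]_n) : R :=
  inf [set a | eigenvalue M a].

Definition erf (R : realType) (x : R) : R :=
  2 / Num.sqrt pi *
  (if 0 <= x then \int[lebesgue_measure]_(t in `[0, x]) expR (- t ^+ 2)
   else - \int[lebesgue_measure]_(t in `[x, 0]) expR (- t ^+ 2)).

(* Meaningful for [y] in the open interval from -1 to 1, the range of the
   injective function [erf]. *)
Definition erf_inv (R : realType) (y : R) : R := [get x : R | erf x = y].

Definition standard_normal (d : measure_display) (T : measurableType d)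
    (R : realType) (P : probability T R) (X : T -> R) : Prop :=
  forall B : set R, measurable B -> pushforward P X B = normal_prob 0 1 B.

Definition mutually_independent (d d' : measure_display)
    (T : measurableType d) (E : measurableType d') (R : realType)
    (P : probability T R) (I : finType) (X : I -> T -> E) : Prop :=
  forall (J : {set I}) (B : I -> set E), (forall i, measurable (B i)) ->
    P (\bigcap_(i in [set` J]) X i @^-1` B i) =
    (\prod_(i in J) P (X i @^-1` B i))%E.

Definition random_normal_vector (d : measure_display) (T : measurableType d)
    (R : realType) (P : probability T R) (n : nat)
    (r : {RV P >-> n.-tuple R}) : Prop :=
  (forall j : 'I_n, standard_normal P (fun w => tnth (r w) j)) /\
  mutually_independent P (fun (j : 'I_n) w => tnth (r w) j).

(* [passmx.rVof e] is the coordinate isomorphism D_S (coordinates as a row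
   vector), and [passmx.vecof e] its inverse when [e] is a basis. *)
Definition coord_inv (R : realType) (V : vectType R)
    (e : (\dim {:V}).-tuple V) (x : (\dim {:V}).-tuple R) : V :=
  passmx.vecof e (\row_j tnth x j).

Definition c_est (R : realType) (lam : R) (nt : nat) (eps : R) : R :=
  (Num.sqrt (2 * lam) * erf_inv (eps `^ (nt%:R^-1)))^-1.

(* The norms are nonnegative, so the neutral element 0 of the iterated maximum
   does not alter it when [nt > 0]. *)
Definition Delta (d : measure_display) (T : measurableType d) (R : realType)
    (P : probability T R) (V W : vectType R)
    (dotV : {dot V for (idfun : R -> R)}) (dotW : {dot W for (idfun : R -> R)})
    (e : (\dim {:V}).-tuple V) (O : 'Hom(V, W)) (nt : nat) (eps : R)
    (r : 'I_nt -> {RV P >-> (\dim {:V}).-tuple R}) (w : T) : R :=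
  c_est (lambda_min (gram_mx dotV e)) nt eps *
  \big[Num.max/0]_(i < nt) dot_norm dotW (O (coord_inv e (r i w))).

(* Main.v *)
Require Import Defs.
From HB Require Import structures.
From mathcomp Require Import all_boot all_order all_algebra.
From mathcomp Require Import all_classical all_reals all_analysis.
From mathcomp Require Import measurable_realfun.
From mathcomp Require Import ring lra.
Import Order.TTheory GRing.Theory Num.Theory.
Import numFieldNormedType.Exports.
Local Open Scope classical_set_scope.
Local Open Scope ring_scope.

(** Fix a nonzero v in S with O v <> 0. Writing u for the unit vector along O v, the
    functional xi |-> <u, O xi> satisfies |<u, O xi>| <= |O xi| and takes the
    value |O v| at v. In coordinates it is x |-> sum_j a_j x_j, and
    Cauchy-Schwarz together with lambda |x|^2 <= |v|^2 (x the coordinates of v,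
    lambda the smallest eigenvalue of the Gram matrix) gives
    sqrt lambda * |O v| / |v| <= |a| ([support_coef_ge]). For a random normal
    vector r, the variable sum_j a_j r_j has the law of |a| Z with Z standard
    normal ([law_linear_combination]). Hence, if the estimator is smaller than
    |O v| / |v|, every r_i satisfies
    |sum_j a_j (r_i)_j| <= |a| sqrt 2 erf_inv (eps^(1/nt)),
    an event of probability erf (erf_inv (eps^(1/nt))) = eps^(1/nt) for each i,
    so of probability eps for all the independent r_i ([Delta_ge_quotient]).

    Since the operator norm is the supremum of the quotients |O v| / |v|, choosing
    v with quotients tending to the supremum and using continuity of P along a
    decreasing sequence of events yields the bound for the norm itself.

    Two facts need a development of their own. That lambda is positive and
    bounds the Rayleigh quotient from below is proved by showing that the infimum
    of the quadratic form on the unit sphere is an eigenvalue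
    ([lambda_min_gt0], [lambda_min_le]). That linear combinations of independent
    normal variables are normal follows by adding one variable at a time, from
    the rotation invariance of the Gaussian measure of the plane
    ([normal_prob_rotation]). *)

Set Implicit Arguments.
Unset Strict Implicit.
Unset Printing Implicit Defensive.

(** * The smallest eigenvalue of a positive definite matrix *)

(** Cauchy-Schwarz without definiteness, so that it applies to the shifted Gram
    matrix below. The quadratic t |-> f (t u + v) (t u + v) is nonnegative;
    reading off its discriminant also covers the case f u u = 0. *)
Lemma psd_form_CS (R : rcfType) (V : lmodType R) (f : V -> V -> R) :
  (forall u v, f u v = f v u) ->
  (forall a u v w, f (a *: u + v) w = a * f u w + f v w) ->
  (forall u, 0 <= f u u) ->
  forall u v, f u v ^+ 2 <= f u u * f v v.
Proof.
move=> fC fP f0 u v.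
pose p : {poly R} := (f u u)%:P * 'X^2 + (2 * f u v)%:P * 'X + (f v v)%:P.
have p_ge0 t : 0 <= p.[t].
  suff -> : p.[t] = f (t *: u + v) (t *: u + v) by [].
  rewrite /p !hornerE /= !fP ![f _ (_ *: _ + _)]fC !fP (fC v u); ring.
have szp : (size p <= 3)%N.
  rewrite /p; apply/leq_sizeP => j j3.
  rewrite !coefD !coefCM coefXn coefX coefC.
  by case: j j3 => [|[|[|j]]] //= _; rewrite !mulr0 !addr0.
have := @deg_le2_poly_ge0 R p szp p_ge0.
rewrite /p !coefD !coefCM !coefXn !coefX !coefC /=; lra.
Qed.

Section rayleigh.
Context {R : realType} {n : nat}.
Implicit Types (A M : 'M[R]_n) (u v : 'rV[R]_n).

Definition mx_form A u v : R := (u *m A *m v^T) 0 0.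

Definition sqnorm u : R := \sum_j u 0 j ^+ 2.

Lemma mx_form1 u : mx_form 1%:M u u = sqnorm u.
Proof.
by rewrite /mx_form mulmx1 mxE; apply: eq_bigr => j _; rewrite mxE expr2.
Qed.

Lemma mulmx_tr_sqnorm u : (u *m u^T) 0 0 = sqnorm u.
Proof. by rewrite -mx_form1 /mx_form mulmx1. Qed.

Lemma mx_formE A u v : mx_form A u v = \sum_j (\sum_i u 0 i * A i j) * v 0 j.
Proof.
by rewrite /mx_form mxE; apply: eq_bigr => j _; rewrite !mxE.
Qed.

Lemma mx_formP A a u v w :
  mx_form A (a *: u + v) w = a * mx_form A u w + mx_form A v w.
Proof. by rewrite /mx_form !mulmxDl -!scalemxAl !mxE. Qed.

Lemma mx_formC A u v : A^T = A -> mx_form A u v = mx_form A v u.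
Proof.
move=> sA; have -> : mx_form A u v = (u *m A *m v^T)^T 0 0 by rewrite mxE.
by rewrite !trmx_mul trmxK sA mulmxA.
Qed.

Lemma mx_formZ A a u : mx_form A (a *: u) (a *: u) = a ^+ 2 * mx_form A u u.
Proof. by rewrite /mx_form linearZ /= -!scalemxAl -scalemxAr !mxE; ring. Qed.

Lemma sqnorm_ge0 u : 0 <= sqnorm u.
Proof. by apply: sumr_ge0 => j _; exact: sqr_ge0. Qed.

Lemma sqnorm_gt0 u : u != 0 -> 0 < sqnorm u.
Proof.
move=> u0; rewrite lt_def sqnorm_ge0 andbT; apply: contra u0 => u0.
apply/eqP/rowP => j; rewrite mxE; apply/eqP; rewrite -sqrf_eq0.
move: u0; rewrite psumr_eq0 => [/allP/(_ j)|i _]; last exact: sqr_ge0.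
by apply; rewrite mem_index_enum.
Qed.

Lemma sqnormZ a u : sqnorm (a *: u) = a ^+ 2 * sqnorm u.
Proof. by rewrite -!mx_form1 mx_formZ. Qed.

Lemma mx_form_bounded A : exists2 C, 0 < C &
  forall u, mx_form A u u <= C * sqnorm u.
Proof.
exists (1 + \sum_j \sum_i `|A i j|) => [|u].
  by apply: ltr_wpDr => //; do 2!apply: sumr_ge0 => ? _.
apply: (@le_trans _ _ ((\sum_j \sum_i `|A i j|) * sqnorm u)); last first.
  by rewrite ler_wpM2r ?sqnorm_ge0// lerDr.
rewrite mx_formE mulr_suml; apply: ler_sum => j _.
rewrite !mulr_suml; apply: ler_sum => i _.
have uu k : u 0 k ^+ 2 <= sqnorm u.
  by rewrite /sqnorm (bigD1 k)//= lerDl sumr_ge0// => l _; exact: sqr_ge0.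
have -> : u 0 i * A i j * u 0 j = A i j * (u 0 i * u 0 j) by ring.
apply: le_trans (ler_norm _) _; rewrite normrM ler_wpM2l// normrM.
have /= := uu i; have /= := uu j; rewrite -!(real_normK (num_real (u _ _))).
have := sqr_ge0 (`|u 0 i| - `|u 0 j|); nra.
Qed.

Section symmetric_positive_definite.
Variable M : 'M[R]_n.
Hypothesis n_gt0 : (0 < n)%N.
Hypothesis symM : M^T = M.
Hypothesis posM : forall u, u != 0 -> 0 < mx_form M u u.

(* The infimum of the quadratic form on the unit sphere. *)
Let m := inf [set mx_form M u u | u in [set u | sqnorm u = 1]].

Let values_lb : has_inf [set mx_form M u u | u in [set u | sqnorm u = 1]].
Proof.
split.
  pose e : 'rV[R]_n := delta_mx 0 (Ordinal n_gt0).
  exists (mx_form M e e), e => //=.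
  rewrite /sqnorm (bigD1 (Ordinal n_gt0))//= mxE !eqxx expr1n.
  rewrite big1 ?addr0// => j /negbTE j0.
  by rewrite mxE j0 andbF expr0n.
exists 0 => _ [u /= u1 <-]; apply/ltW/posM; apply/eqP => u0.
move: u1; rewrite u0 /sqnorm big1 => [/eqP|j _]; first by rewrite eq_sym oner_eq0.
by rewrite mxE expr0n.
Qed.

Let inf_le u : m * sqnorm u <= mx_form M u u.
Proof.
have [->|u0] := eqVneq u 0.
  by rewrite -mx_form1 /mx_form !mul0mx mxE mulr0.
have su := sqnorm_gt0 u0.
pose t := (Num.sqrt (sqnorm u))^-1.
have t2 : t ^+ 2 = (sqnorm u)^-1 by rewrite exprVn sqr_sqrtr// ltW.
have : m <= mx_form M (t *: u) (t *: u).
  apply: ge_inf; first exact: values_lb.2.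
  by exists (t *: u) => //=; rewrite sqnormZ t2 mulVf// gt_eqF.
by rewrite mx_formZ t2 mulrC ler_pdivlMr.
Qed.

Let shifted u v : mx_form (M - m%:M) u v = mx_form M u v - m * mx_form 1%:M u v.
Proof.
rewrite /mx_form mulmxBr mulmxBl mul_mx_scalar mulmx1 -scalemxAl.
by rewrite !mxE.
Qed.

(** If A = M - m were invertible, then |u|^2 <= C |u A|^2, while Cauchy-Schwarz
    for the semidefinite form of A gives |u A|^4 <= (u A u^T) (C |u A|^2).
    Together they bound u A u^T below by a positive multiple of |u|^2, so m would
    not be the infimum. *)
Let inf_eigenvalue : eigenvalue M m.
Proof.
rewrite /eigenvalue /eigenspace kermx_eq0 row_free_unit.
set A := M - m%:M; apply/negP => uA.
have symA : A^T = A by rewrite /A linearB /= symM tr_scalar_mx.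
have psdA u : 0 <= mx_form A u u.
  by rewrite shifted mx_form1 subr_ge0 inf_le.
have CS := psd_form_CS (fun u v => mx_formC u v symA) (@mx_formP A) psdA.
have [C1 C1p bnd1] := mx_form_bounded A.
have [C2 C2p bnd2] := mx_form_bounded (invmx A *m (invmx A)^T).
have gap u : sqnorm u <= C1 * C2 * mx_form A u u.
  pose w := u *m A.
  have uw : u = w *m invmx A by rewrite /w mulmxK.
  have le1 : sqnorm u <= C2 * sqnorm w.
    rewrite -mx_form1 {1 2}uw (le_trans _ (bnd2 w))// /mx_form.
    by rewrite mulmx1 trmx_mul !mulmxA.
  have le2 : sqnorm w ^+ 2 <= mx_form A u u * (C1 * sqnorm w).
    rewrite -{1}mulmx_tr_sqnorm; apply: le_trans (CS u w) _.
    by rewrite ler_wpM2l.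
  have [w0|wN0] := eqVneq (sqnorm w) 0.
    rewrite w0 mulr0 in le1; apply: le_trans le1 _.
    by rewrite !mulr_ge0// ltW.
  have wp : 0 < sqnorm w by rewrite lt_def wN0 sqnorm_ge0.
  have le3 : sqnorm w <= mx_form A u u * C1.
    by rewrite -(ler_pM2r wp) -mulrA -expr2.
  apply: le_trans le1 _; have := ler_wpM2l (ltW C2p) le3; lra.
have Cp : 0 < C1 * C2 by rewrite mulr_gt0.
suff : m + (C1 * C2)^-1 <= m by rewrite gerDl leNgt invr_gt0 Cp.
apply: lb_le_inf; first exact: values_lb.1.
move=> _ [u /= u1 <-]; have := gap u; rewrite shifted mx_form1 u1 mulr1.
by rewrite -ler_pdivrMl// mulr1; lra.
Qed.

(* Every eigenvalue is a value of the form on the sphere, hence at least m. *)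
Let lambda_min_inf : lambda_min M = m.
Proof.
have lbm : lbound [set a | eigenvalue M a] m.
  move=> a /= /eigenvalueP[v vM v0].
  have := inf_le v; rewrite {1}/mx_form vM -scalemxAl mxE.
  by rewrite mulmx_tr_sqnorm ler_pM2r// sqnorm_gt0.
apply/eqP; rewrite eq_le; apply/andP; split.
  by apply: ge_inf; [exists m|exact: inf_eigenvalue].
by apply: lb_le_inf => //; exists m; exact: inf_eigenvalue.
Qed.

Lemma lambda_min_gt0 : 0 < lambda_min M.
Proof.
rewrite lambda_min_inf; have /eigenvalueP[v vM v0] := inf_eigenvalue.
have := posM v0; rewrite /mx_form vM -scalemxAl mxE.
by rewrite mulmx_tr_sqnorm pmulr_lgt0// sqnorm_gt0.
Qed.

Lemma lambda_min_le u : lambda_min M * sqnorm u <= mx_form M u u.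
Proof. by rewrite lambda_min_inf. Qed.

End symmetric_positive_definite.
End rayleigh.

(** * Affine images of the normal law *)

(** The measure structure on [pushforward m f] depends on a proof that f is
    measurable, which unification cannot find; here it is passed explicitly. *)
Definition image_measure (R : realType) d d' (T1 : measurableType d) (T2 : measurableType d')
  (m : {measure set T1 -> \bar R}) (f : T1 -> T2)
  (mf : measurable_fun [set: T1] f) : {measure set T2 -> \bar R} :=
  measure_function_pushforward__canonical__measure_function_Measure m mf.

Section affine.
Context {R : realType}.
Local Notation mu := (@lebesgue_measure R).
Local Notation N := (@normal_prob R 0 1).

Let measurable_affine (m s : R) :
  measurable_fun [set: measurableTypeR R] (fun y => m + s * y : measurableTypeR R).
Proof. by apply: measurable_funD => //; apply: measurable_funM. Qed.

Lemma lebesgue_measure_affine (m s : R) (B : set R) : s != 0 -> measurable B ->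
  (mu B = `|s|%:E * mu ((fun y : R => (m + s * y)%R) @^-1` B))%E.
Proof.
move=> s0 mB.
pose f : R -> measurableTypeR R := fun y => m + s * y.
pose nu : {measure set (measurableTypeR R) -> \bar R} :=
  mscale (NngNum (normr_ge0 s)) (image_measure mu (measurable_affine m s)).
have -> : (`|s|%:E * mu ((fun y : R => (m + s * y)%R) @^-1` B))%E = nu B by [].
apply: lebesgue_measure_unique => // _ [[a b] _ <-] /=.
rewrite /mscale /= /pushforward.
have [sp|sn|/eqP] := ltgtP 0 s; last by rewrite eq_sym (negbTE s0).
- have -> : f @^-1` `]a, b]%classic = `](a - m) / s, (b - m) / s]%classic.
    apply/seteqP; split => y /=; rewrite !in_itv /= /f ltr_pdivrMr// ler_pdivlMr//;
      by rewrite mulrC ltrBlDl lerBrDl.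
  rewrite !lebesgue_measure_itv /= !lte_fin ltr_pM2r ?invr_gt0// ltrD2r.
  case: ifP => _; last by rewrite mule0.
  by rewrite -!EFinD -EFinM gtr0_norm//; congr EFin; field.
- have -> : f @^-1` `]a, b]%classic = `[(b - m) / s, (a - m) / s[%classic.
    apply/seteqP; split => y /=; rewrite !in_itv /= /f => /andP[h1 h2]; apply/andP.
      by rewrite ler_ndivrMr// ltr_ndivlMr// mulrC; split; lra.
    by move: h1 h2; rewrite ler_ndivrMr// ltr_ndivlMr// mulrC; split; lra.
  rewrite !lebesgue_measure_itv /= !lte_fin ltr_nM2r ?invr_lt0// ltrD2r.
  case: ifP => _; last by rewrite mule0.
  by rewrite -!EFinD -EFinM ltr0_norm//; congr EFin; field.
Qed.

(** If Z is standard normal then m + s Z has density [normal_pdf m s]. A negative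
    s is admitted, which yields the symmetry of the standard normal law. *)
Lemma normal_prob_affine (m s : R) (B : set R) : s != 0 -> measurable B ->
  N ((fun y : R => m + s * y) @^-1` B) = normal_prob m s B.
Proof.
move=> s0 mB.
pose f : measurableTypeR R -> measurableTypeR R := fun y => m + s * y.
have mf : measurable_fun [set: measurableTypeR R] f by exact: measurable_affine.
pose nu := image_measure mu mf.
have pdfE y : normal_pdf 0 1 y = `|s| * normal_pdf m s (f y).
  rewrite !normal_pdfE ?oner_eq0// /normal_peak /normal_fun /f mulrA; congr (_ * _).
    rewrite expr1n mul1r -(mulrnAr (s ^+ 2)) (sqrtrM _ (sqr_ge0 s)) sqrtr_sqr.
    by rewrite invfM mulrA divff ?normr_eq0// mul1r.
  by congr expR; field.
rewrite /normal_prob.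
under eq_integral do rewrite pdfE EFinM.
have mB' : measurable (f @^-1` B) by rewrite -[X in measurable X]setTI; apply: (mf).
have mg : measurable_fun setT (fun y : measurableTypeR R => (normal_pdf m s y)%:E).
  by apply/measurable_EFinP; exact: measurable_normal_pdf.
have g0 y : (0 <= (normal_pdf m s y)%:E)%E by rewrite lee_fin normal_pdf_ge0.
rewrite ge0_integralZl_EFin//; last first.
  by apply: measurable_funTS; exact: (measurableT_comp mg).
rewrite -(ge0_integral_pushforward mf mu (f := fun y => (normal_pdf m s y)%:E)) //;
  last exact: measurable_funTS.
rewrite -[`|s|]/((NngNum (normr_ge0 s))%:num) -ge0_integral_mscale//;
  last exact: measurable_funTS.
by apply: eq_measure_integral => A mA _; exact/esym/lebesgue_measure_affine.
Qed.
End affine.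

(** * Rotation invariance of the Gaussian measure of the plane *)

Section rotation.
Context {R : realType}.
Local Notation mu := (@lebesgue_measure R).
Local Notation N := (@normal_prob R 0 1).

(** By uniqueness of the Radon-Nikodym derivative, the density takes its place in
    the change of variables formula. *)
Lemma integral_normal_prob (m s : R) (f : R -> \bar R) :
  (normal_prob m s).-integrable setT f ->
  (\int[normal_prob m s]_x f x = \int[mu]_x (f x * (normal_pdf m s x)%:E))%E.
Proof.
move=> fi; have mf : measurable_fun [set: measurableTypeR R] f by exact: (measurable_int _ fi).
have dom := normal_prob_dominates m s.
have mpdf : measurable_fun [set: measurableTypeR R] (EFin \o normal_pdf m s).
  by apply/measurable_EFinP; exact: measurable_normal_pdf.
rewrite -(Radon_Nikodym_change_of_variables dom)//=.
apply: ae_eq_integral => //; [exact: emeasurable_funM..| ].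
apply: ae_eqe_mul2l.
apply: integral_ae_eq => //; first exact: Radon_Nikodym_integrable.
by move=> E _ mE; rewrite -Radon_Nikodym_integral.
Qed.

(** The joint density at (x, z) of X and Z = c X + s Y, for independent standard
    normal X and Y: it is symmetric, the exponent being
    - (x^2 - 2 c x z + z^2) / (2 s^2). *)
Lemma normal_pdf_swap (c s x z : R) : s != 0 -> c ^+ 2 + s ^+ 2 = 1 ->
  normal_pdf 0 1 x * normal_pdf (c * x) s z =
  normal_pdf 0 1 z * normal_pdf (c * z) s x.
Proof.
move=> s0 cs; rewrite !normal_pdfE ?oner_eq0// /normal_fun mulrACA [RHS]mulrACA -!expRD.
congr (_ * expR _).
rewrite !subr0 expr1n -(mulr_natl (s ^+ 2)).
have H : forall a b : R, - a / 2 + - b / (2 * s ^+ 2) =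
   - (a * s ^+ 2 + b) / (2 * s ^+ 2) by move=> a b; field.
rewrite !H; congr (_ / _).
have -> : s ^+ 2 = 1 - c ^+ 2 by rewrite -cs addrC addKr.
by ring.
Qed.

Lemma measurable_preimage_scale (c : R) (B : set R) : measurable B ->
  measurable [set x : measurableTypeR R | B (c * x)].
Proof.
move=> mB.
have mf : measurable_fun setT (fun x : measurableTypeR R => c * x : measurableTypeR R).
  exact: measurable_funM.
by have := mf measurableT _ mB; rewrite setTI.
Qed.

Let measurable_rot (c s : R) (B : set R) : measurable B ->
  measurable [set p : measurableTypeR R * measurableTypeR R | B (c * p.1 + s * p.2)].
Proof.
move=> mB.
have mf : measurable_fun setT (fun p : measurableTypeR R * measurableTypeR R =>
    c * p.1 + s * p.2 : measurableTypeR R).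
  by apply: measurable_funD; apply: measurable_funM.
by have := mf measurableT _ mB; rewrite setTI.
Qed.

Lemma normal_prob_opp (B : set R) : measurable B -> N (-%R @^-1` B) = N B.
Proof.
move=> mB; have := @normal_prob_affine R 0 (-1) B _ mB.
have -> : (fun y : R => 0 + -1 * y) = -%R.
  by apply/funext => y; rewrite add0r mulN1r.
move=> ->; last by rewrite oppr_eq0 oner_eq0.
apply: eq_integral => x _; congr EFin.
by rewrite !normal_pdfE ?oppr_eq0 ?oner_eq0// /normal_peak /normal_fun sqrrN.
Qed.

(** Invariance of the standard Gaussian measure of the plane under rotations, in
    the form: a projection on a unit direction is standard normal. Conditionally
    on X = x, the variable c X + s Y is normal with mean c x and variance s^2; by
    Fubini and the symmetry of the joint density, integrating x out leaves the
    standard normal density. *)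
Lemma normal_prob_rotation (c s : R) (B : set R) :
  c ^+ 2 + s ^+ 2 = 1 -> measurable B ->
  (N \x N)%E [set p | B (c * p.1 + s * p.2)] = N B.
Proof.
move=> cs mB; have [s0|s0] := eqVneq s 0.
  (* Then c = 1 or c = -1. *)
  have -> : [set p : R * R | B (c * p.1 + s * p.2)] = [set x | B (c * x)] `*` setT.
    by apply/seteqP; split => -[x y] /=; rewrite s0 mul0r addr0; tauto.
  have mcB := measurable_preimage_scale c mB.
  transitivity (N [set x | B (c * x)%R] * N setT)%E; first by rewrite product_measure1E.
  have -> : N setT = 1%E by exact: probability_setT.
  rewrite mule1.
  move/eqP: cs; rewrite s0 expr0n addr0 sqrf_eq1 => /orP[|] /eqP c1.
    rewrite (_ : [set x | B (c * x)] = B)//.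
    by apply/seteqP; split => x /=; rewrite c1 mul1r.
  rewrite -(normal_prob_opp mB) (_ : [set x | B (c * x)] = -%R @^-1` B)//.
  by apply/seteqP; split => x /=; rewrite c1 mulN1r.
pose A := [set p : R * R | B (c * p.1 + s * p.2)].
have secE x : N (xsection A x) = normal_prob (c * x) s B.
  rewrite -(normal_prob_affine (c * x) s0 mB)
    (_ : xsection A x = (fun y => c * x + s * y) @^-1` B)//.
  by apply/seteqP; split => y; rewrite /xsection /= inE.
have mA := measurable_rot c s mB.
have mdens : measurable_fun setT (fun p : measurableTypeR R * measurableTypeR R =>
    (normal_pdf 0 1 p.1 * normal_pdf (c * p.1) s p.2)%:E).
  apply/measurable_EFinP/measurable_funM.
    by apply: measurableT_comp => //; exact: measurable_normal_pdf.
  rewrite (_ : (fun _ => _) = fun p => normal_pdf 0 s (p.2 - c * p.1)).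
    apply: measurableT_comp; first exact: measurable_normal_pdf.
    by apply: measurable_funB => //; apply: measurable_funM.
  by apply/funext => p; rewrite !normal_pdfE// /normal_fun subr0.
rewrite /product_measure1.
transitivity (\int[mu]_x \int[mu]_z
   ((normal_pdf 0 1 x * normal_pdf (c * x) s z)%:E * (\1_B z)%:E))%E.
  rewrite integral_normal_prob.
    apply: eq_integral => x _; rewrite /= secE.
    rewrite /normal_prob integral_mkcond muleC -ge0_integralZl_EFin ?normal_pdf_ge0//.
    - apply: eq_integral => z _; rewrite patchE indicE EFinM; case: ifPn => _.
        by rewrite mule1.
      by rewrite !mule0.
    - by move=> z _; rewrite patchE; case: ifPn => // _; rewrite lee_fin normal_pdf_ge0.
    - apply/(measurable_restrictT _ _).1 => //; apply: measurable_funTS.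
      by apply/measurable_EFinP; exact: measurable_normal_pdf.
  apply: (@le_integrable _ _ _ N _ measurableT _ (cst 1%E));
    last exact: (finite_measure_integrable_cst N 1).
    exact: measurable_fun_xsection.
  move=> x _; rewrite /= normr1 gee0_abs ?measure_ge0// secE.
  exact: probability_le1.
rewrite (fubini_tonelli (fun p : measurableTypeR R * measurableTypeR R =>
   ((normal_pdf 0 1 p.1 * normal_pdf (c * p.1) s p.2)%:E * (\1_B p.2)%:E)%E)) /=; last 2 first.
- apply: emeasurable_funM => //; apply/measurable_EFinP.
  by apply: measurableT_comp => //.
- by move=> p; rewrite mule_ge0 ?lee_fin ?mulr_ge0 ?normal_pdf_ge0.
rewrite /normal_prob [RHS]integral_mkcond; apply: eq_integral => z _.
under eq_integral do rewrite normal_pdf_swap//.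
rewrite patchE indicE; case: ifPn => _; last first.
  by under eq_integral do rewrite mule0; rewrite integral0.
under eq_integral do rewrite mule1 EFinM.
rewrite ge0_integralZl_EFin ?normal_pdf_ge0//.
- by rewrite integral_normal_pdf mule1.
- by move=> x _; rewrite lee_fin normal_pdf_ge0.
- by apply/measurable_EFinP; exact: measurable_normal_pdf.
Qed.

End rotation.

(** * The error function *)

Section erf.
Context {R : realType}.
Local Notation mu := (@lebesgue_measure R).
Local Notation N := (@normal_prob R 0 1).

Let integrable_gauss_itv (a b : R) :
  mu.-integrable `[a, b] (EFin \o @gauss_fun R).
Proof. by apply: (integrableS measurableT) => //; exact: integrableT_gauss. Qed.

Let measurable_gauss (D : set (measurableTypeR R)) : measurable_fun D (EFin \o @gauss_fun R).
Proof. by apply/measurable_EFinP/measurable_funTS; exact: measurable_gauss_fun. Qed.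

Lemma erf_ge0E (x : R) : 0 <= x ->
  (erf x)%:E = ((2 / Num.sqrt pi)%:E * \int[mu]_(t in `[0%R, x]) (gauss_fun t)%:E)%E.
Proof.
move=> x0; rewrite /erf x0 EFinM /Rintegral fineK//.
exact: (integrable_fin_num _ (integrable_gauss_itv 0 x)).
Qed.

Lemma erf_le0 (x : R) : x <= 0 -> erf x <= 0.
Proof.
move=> x0; rewrite /erf; case: ifPn => [x0'|_].
  have -> : x = 0 by apply/le_anti/andP.
  by rewrite set_itv1 Rintegral_set1 mulr0.
rewrite mulrN oppr_le0 mulr_ge0//.
by apply: Rintegral_ge0 => t _; exact: expR_ge0.
Qed.

Lemma integral_gauss_sym (x : R) : 0 <= x ->
  (\int[mu]_(t in `[(- x)%R, x]) (gauss_fun t)%:E =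
   2%:E * \int[mu]_(t in `[0%R, x]) (gauss_fun t)%:E)%E.
Proof.
move=> x0.
rewrite (@itv_bndbnd_setU _ _ _ (BRight 0)) ?bnd_simp ?oppr_le0//.
rewrite ge0_integral_setU//=; last 2 first.
- by move=> t _; rewrite lee_fin gauss_fun_ge0.
- rewrite disj_set2E; apply/eqP; rewrite -subset0 => t [] /=.
  by rewrite !in_itv/= => /andP[_ t0] /andP[]; rewrite ltNge t0.
rewrite integral_itv_obnd_cbnd; last exact: measurable_gauss.
have := @integration_by_substitution_oppr R gauss_fun 0 x x0.
rewrite oppr0 => ->; last exact/continuous_subspaceT/continuous_gauss_fun.
rewrite mule_natl mule2n; congr (_ + _)%E.
by apply: eq_integral => t _; rewrite /= /gauss_fun sqrrN.
Qed.

(** Z / sqrt 2 has density exp (- t^2) / sqrt pi. *)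
Lemma normal_prob_erf (x : R) : 0 <= x ->
  N [set z | `|z| <= Num.sqrt 2 * x] = (erf x)%:E.
Proof.
move=> x0.
have s20 : 0 < Num.sqrt 2 :> R by rewrite sqrtr_gt0.
pose s : R := (Num.sqrt 2)^-1.
have s0 : s != 0 by rewrite invr_neq0// gt_eqF.
have s2 : s ^+ 2 = 2^-1 by rewrite exprVn sqr_sqrtr.
have -> : [set z | `|z| <= Num.sqrt 2 * x] =
    (fun y => 0 + s * y) @^-1` `[- x, x]%classic.
  rewrite predeqE => z /=; rewrite in_itv /= -ler_norml add0r.
  by rewrite normrM normfV (gtr0_norm s20) ler_pdivrMl.
rewrite normal_prob_affine// /normal_prob.
have pdfE t : normal_pdf 0 s t = (Num.sqrt pi)^-1 * gauss_fun t.
  rewrite normal_pdfE// /normal_peak /normal_fun /gauss_fun subr0 s2 -mulrnAl.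
  have -> : 2^-1 *+ 2 = 1 :> R by field.
  by rewrite mul1r divr1.
under eq_integral do rewrite pdfE EFinM.
rewrite ge0_integralZl_EFin//; last 1 first.
- by move=> t _; rewrite lee_fin gauss_fun_ge0.
rewrite integral_gauss_sym// erf_ge0E// muleA -EFinM.
by rewrite [(_^-1 * 2)]mulrC.
Qed.

(** Intermediate value theorem between erf 0 = 0 and erf b > y, where b exists
    because the Gauss integral forces erf to tend to 1. *)
Lemma erf_surj (y : R) : 0 < y < 1 -> exists x : R, erf x = y.
Proof.
move=> /andP[y0 y1].
have sp : 0 < Num.sqrt pi :> R by rewrite sqrtr_gt0 pi_gt0.
have cp : 0 < 2 / Num.sqrt pi :> R by rewrite divr_gt0.
have [n yn] : exists n, y < erf (n.+1%:R : R).
  have : ((y * (Num.sqrt pi / 2))%:E < \int[mu]_(x in `[0%R, +oo[) (gauss_fun x)%:E)%E.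
    by rewrite integral0y_gauss lte_fin gtr_pMl// divr_gt0.
  rewrite (ge0_integral_ereal_sup mu gauss_fun_ge0 measurable_gauss_fun).
  move=> /ereal_sup_gt[_ [n _ <-]] h; exists n.
  rewrite -lte_fin erf_ge0E//.
  rewrite -(@lte_pmul2l _ (2 / Num.sqrt pi)%:E) ?lte_fin// -EFinM in h.
  rewrite (_ : 2 / _ * _ = y) // in h.
  by field; rewrite gt_eqF.
pose b : R := n.+1%:R.
have [] := @IVT R (fun x => 2 / Num.sqrt pi * \int[mu]_(t in `[0, x]) gauss_fun t) 0 b y.
- by [].
- move=> x; apply: cvgM; first exact: cvg_cst.
  exact: (parameterized_integral_continuous (ler0n _ _) (integrable_gauss_itv 0 b)).
- have e0 : 2 / Num.sqrt pi * \int[mu]_(t in `[0, 0]) gauss_fun t = 0 :> R.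
    by rewrite set_itv1 Rintegral_set1 mulr0.
  have eb : 2 / Num.sqrt pi * \int[mu]_(t in `[0, b]) gauss_fun t = erf b.
    by rewrite /erf ler0n.
  by rewrite e0 eb ge_min le_max ltW//= (ltW yn) orbT.
- move=> c; rewrite in_itv /= => /andP[c0 _] <-; exists c.
  by rewrite /erf c0.
Qed.

Lemma erf_invK (y : R) : 0 < y < 1 -> erf (erf_inv y) = y.
Proof. by move=> /erf_surj [x ex]; exact: (getPex (ex_intro (fun x => erf x = y) x ex)). Qed.

Lemma erf_inv_gt0 (y : R) : 0 < y < 1 -> 0 < erf_inv y.
Proof.
move=> y01; have /andP[y0 _] := y01; rewrite ltNge; apply/negP => /erf_le0.
by rewrite erf_invK// leNgt y0.
Qed.

End erf.

(** * Linear combinations of independent normal variables *)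

Lemma eq_measure_rectangles (R : realType) d1 d2 (T1 : measurableType d1)
    (T2 : measurableType d2) (m1 m2 : {measure set (T1 * T2) -> \bar R}) :
  (m1 setT < +oo)%E ->
  (forall A B, measurable A -> measurable B -> m1 (A `*` B) = m2 (A `*` B)) ->
  forall D, measurable D -> m1 D = m2 D.
Proof.
move=> m1fin m12 D mD.
pose C : set (set (T1 * T2)) :=
  [set C | exists A, measurable A /\ exists B, measurable B /\ C = A `*` B].
apply: (measure_unique C (fun=> setT)) => //.
- rewrite measurable_prod_measurableType //; congr (<<s _ >>).
  rewrite predeqE; split => [[A mA [B mB <-]]|[A [mA [B [mB ->]]]]].
    by exists A; split => //; exists B.
  by exists A => //; exists B.
- move=> /= _ _ [X1 [mX1 [X2 [mX2 ->]]]] [Y1 [mY1 [Y2 [mY2 ->]]]].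
  rewrite -setXI; exists (X1 `&` Y1); split; first exact: measurableI.
  by exists (X2 `&` Y2); split => //; exact: measurableI.
- by move=> _; exists setT; split => //; exists setT; split => //; rewrite setXTT.
- by rewrite bigcup_const//; exists 0%N.
- by move=> _ [A [mA [B [mB ->]]]]; exact: m12.
Qed.

Section linear_combination.
Context {R : realType} d (T : measurableType d) (P : probability T R).
Local Notation N := (@normal_prob R 0 1).

(** Reduction to [normal_prob_rotation] by homogeneity; when both coefficients
    vanish the two sides are the mass at 0. *)
Lemma normal_prob_lincomb (s a : R) (B : set R) : measurable B ->
  (N \x N)%E [set p | B (s * p.1 + a * p.2)] =
  N [set z | B (Num.sqrt (s ^+ 2 + a ^+ 2) * z)].
Proof.
move=> mB; set rho := Num.sqrt _.
have rho2 : rho ^+ 2 = s ^+ 2 + a ^+ 2.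
  by rewrite sqr_sqrtr// addr_ge0// sqr_ge0.
have [rho0|rhoN0] := eqVneq rho 0.
  have /eqP := rho2; rewrite rho0 expr0n /= eq_sym.
  rewrite paddr_eq0 ?sqr_ge0// !sqrf_eq0 => /andP[/eqP -> /eqP ->].
  have [B0|nB0] := pselect (B 0).
    rewrite [X in (N \x N)%E X](_ : _ = setT); last first.
      by apply/seteqP; split => // p _ /=; rewrite !mul0r addr0.
    rewrite [X in N X](_ : _ = setT); last first.
      by apply/seteqP; split => // z _ /=; rewrite mul0r.
    transitivity (N setT * N setT)%E.
      by rewrite -setXTT product_measure1E.
    have -> : N setT = 1%E by exact: probability_setT.
    by rewrite mule1.
  rewrite [X in (N \x N)%E X](_ : _ = set0); last first.
    by apply/seteqP; split => // p /=; rewrite !mul0r addr0.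
  rewrite [X in N X](_ : _ = set0); last first.
    by apply/seteqP; split => // z /=; rewrite mul0r.
  by rewrite !measure0.
have mrB := measurable_preimage_scale rho mB.
rewrite -(@normal_prob_rotation R (s / rho) (a / rho) _ _ mrB).
  congr ((N \x N)%E _); apply/seteqP; split => p /=; congr B; by field.
rewrite !expr_div_n rho2 -mulrDl divff// -rho2 expf_neq0//.
Qed.

Variables (n : nat) (X : 'I_n -> T -> R).
Hypothesis mX : forall j, measurable_fun setT (X j).
Hypothesis normalX : forall j, standard_normal P (X j).
Hypothesis indepX : mutually_independent P X.
Variable a : 'I_n -> R.

Let S k w := \sum_(j < n | (j < k)%N) a j * X j w.
Let s k := Num.sqrt (\sum_(j < n | (j < k)%N) a j ^+ 2).
Let tail k := [set j : 'I_n | (k <= j)%N]%SET.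
Let E k (C : 'I_n -> set R) := \bigcap_(i in [set` tail k]) X i @^-1` C i.

Let mS k : measurable_fun setT (S k).
Proof.
rewrite (_ : S k = fun w => \sum_(j < n) (if (j < k)%N then a j * X j w else 0)).
  apply: measurable_sum => j; case: (j < k)%N; last exact: measurable_cst.
  exact: measurable_funM.
by apply/funext => w; rewrite /S big_mkcond.
Qed.

Let mpreX (C : 'I_n -> set R) : (forall j, measurable (C j)) ->
  forall j, measurable (X j @^-1` C j).
Proof. by move=> mC j; rewrite -[X in measurable X]setTI; exact: mX. Qed.

Let mE k (C : 'I_n -> set R) : (forall j, measurable (C j)) -> measurable (E k C).
Proof.
move=> mC; apply: fin_bigcap_measurable => [|j _]; first exact: finite_finset.
exact: mpreX.
Qed.

Let tail_step (i : 'I_n) : tail i = (i |: tail i.+1)%SET.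
Proof. by apply/setP => j; rewrite !inE leq_eqVlt eq_sym. Qed.

Let E_step (i : 'I_n) C : E i C = X i @^-1` C i `&` E i.+1 C.
Proof.
rewrite /E tail_step; apply/seteqP; split => w /=.
  move=> h; split; first by apply: (h i); rewrite /= !inE eqxx.
  by move=> j /= jt; apply: (h j); rewrite /= inE jt orbT.
by move=> [wi h] j /=; rewrite !inE => /orP[/eqP ->//|jt]; apply: (h j); rewrite /= inE.
Qed.

Let P_E_step (i : 'I_n) C : (forall j, measurable (C j)) ->
  (P (E i C) = N (C i) * P (E i.+1 C))%E.
Proof.
move=> mC; rewrite /E !indepX// tail_step big_setU1 /=; last by rewrite inE ltnn.
by congr (_ * _)%E; exact: normalX.
Qed.

(** The induction adds one summand at a time. To do so it must carry the
    independence of the partial sum S k from the remaining variables, whence the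
    event E k C. In the step, the joint law of (S k, X k) restricted to the event
    E k.+1 C is, on rectangles, a multiple of the law of (s k Z, Z') with Z, Z'
    independent standard normal; so the two agree on every Borel set of the
    plane, in particular on the one where u + a k v lies in B. *)
Let joint_law k C B : (k <= n)%N -> (forall j, measurable (C j)) -> measurable B ->
  (P ([set w | B (S k w)] `&` E k C) = N [set z | B (s k * z)%R] * P (E k C))%E.
Proof.
elim: k C B => [|k IH] C B kn mC mB.
  have S0 w : S 0 w = 0 by rewrite /S big_pred0.
  have s0 z : s 0 * z = 0 by rewrite /s big_pred0// sqrtr0 mul0r.
  have [B0|nB0] := pselect (B 0).
    rewrite (_ : [set w | B (S 0 w)] = setT); last first.
      by apply/seteqP; split => // w _ /=; rewrite S0.
    rewrite (_ : [set z | B (s 0 * z)] = setT); last first.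
      by apply/seteqP; split => // w _ /=; rewrite s0.
    have -> : N setT = 1%E by exact: probability_setT.
    by rewrite setTI mul1e.
  rewrite (_ : [set w | B (S 0 w)] = set0); last first.
    by apply/seteqP; split => // w /=; rewrite S0.
  rewrite (_ : [set z | B (s 0 * z)] = set0); last first.
    by apply/seteqP; split => // w /=; rewrite s0.
  by rewrite set0I !measure0 mul0e.
pose i : 'I_n := Ordinal kn.
have SE w : S k.+1 w = S k w + a i * X i w.
  rewrite /S (bigD1 i)//= addrC; congr (_ + _); apply: eq_bigl => j.
  by rewrite ltnS [RHS]ltn_neqAle andbC.
have sE : s k.+1 = Num.sqrt (s k ^+ 2 + a i ^+ 2).
  rewrite /s sqr_sqrtr; last by apply: sumr_ge0 => j _; exact: sqr_ge0.
  congr Num.sqrt; rewrite (bigD1 i)//= addrC; congr (_ + _); apply: eq_bigl => j.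
  by rewrite ltnS [RHS]ltn_neqAle andbC.
have mEk : measurable (E k.+1 C) by exact: mE.
have mSX : measurable_fun setT
    (fun w => (S k w : measurableTypeR R, X i w : measurableTypeR R)).
  apply: measurable_fun_pair; [exact: mS|exact: mX].
have msc : measurable_fun setT (fun p : measurableTypeR R * measurableTypeR R =>
    (s k * p.1 : measurableTypeR R, p.2 : measurableTypeR R)).
  by apply: measurable_fun_pair => //; exact: measurable_funM.
pose c : {nonneg R} := NngNum (fine_ge0 (measure_ge0 P (E k.+1 C))).
pose m1 : {measure set (measurableTypeR R * measurableTypeR R) -> \bar R} :=
  image_measure (mrestr P mEk) mSX.
pose m2 : {measure set (measurableTypeR R * measurableTypeR R) -> \bar R} :=
  mscale c (image_measure (N \x N)%E msc).
pose D := [set p : measurableTypeR R * measurableTypeR R | B (p.1 + a i * p.2)].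
have mD : measurable D.
  have mf : measurable_fun setT (fun p : measurableTypeR R * measurableTypeR R =>
      p.1 + a i * p.2 : measurableTypeR R).
    by apply: measurable_funD => //; apply: measurable_funM.
  by have := mf measurableT _ mB; rewrite setTI.
have cE : (fine (P (E k.+1 C)))%:E = P (E k.+1 C).
  by rewrite fineK// fin_num_measure.
have m1E Q : m1 Q = P ((fun w => (S k w, X i w)) @^-1` Q `&` E k.+1 C) by [].
have m2E Q : m2 Q = (P (E k.+1 C) *
    (N \x N) ((fun p => ((s k * p.1)%R, p.2)) @^-1` Q))%E by rewrite -cE.
have : m1 D = m2 D.
  apply: eq_measure_rectangles => // [|A1 A2 mA1 mA2].
    rewrite m1E; apply: le_lt_trans (ltry 1); apply: probability_le1.
    apply: measurableI => //; rewrite -[X in measurable X]setTI.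
    exact: (mSX measurableT).
  (* Apply the induction hypothesis with the constraint on X k replaced by A2. *)
  pose C' j := if j == i then A2 else C j.
  have mC' j : measurable (C' j) by rewrite /C'; case: ifP => _; [exact: mA2|exact: mC].
  have EC' : E k.+1 C' = E k.+1 C.
    apply: eq_bigcapr => j /=; rewrite inE /C'; case: eqP => // ->.
    by rewrite ltnn.
  have := IH C' A1 (ltnW kn) mC' mA1.
  rewrite -[k in E k C']/(nat_of_ord i) P_E_step// E_step EC' {1 2}/C' eqxx => IHk.
  rewrite m1E m2E.
  transitivity (P ([set w | A1 (S k w)] `&` (X i @^-1` A2 `&` E k.+1 C))).
    by rewrite setIA.
  rewrite IHk muleA muleC; congr (_ * _)%E.
  transitivity ((N \x N)%E ([set z | A1 (s k * z)] `*` A2)); last by [].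
  rewrite product_measure1E//.
  exact: measurable_preimage_scale.
rewrite m1E m2E => E12.
transitivity (P ((fun w => (S k w, X i w)) @^-1` D `&` E k.+1 C)).
  by congr (P (_ `&` _)); apply/seteqP; split => w /=; rewrite SE.
rewrite E12 muleC; congr (_ * _)%E.
by rewrite sE -normal_prob_lincomb.
Qed.

(** A linear combination of independent standard normal variables is distributed
    as the Euclidean norm of the coefficients times a standard normal one. *)
Lemma law_linear_combination (B : set R) : measurable B ->
  P [set w | B (\sum_j a j * X j w)] =
  N [set z | B (Num.sqrt (\sum_j a j ^+ 2) * z)].
Proof.
move=> mB; have := @joint_law n (fun=> setT) B (leqnn n) (fun=> measurableT) mB.
have -> : E n (fun=> setT) = setT.
  by apply/seteqP; split.
rewrite setIT probability_setT mule1.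
have big_n (F : 'I_n -> R) : \sum_(j < n | (j < n)%N) F j = \sum_j F j.
  by apply: eq_bigl => j; rewrite ltn_ord.
have SE w : S n w = \sum_j a j * X j w by rewrite /S big_n.
rewrite /s big_n => <-.
rewrite (_ : [set w | B (S n w)] = [set w | B (\sum_j a j * X j w)])//.
by apply/seteqP; split => w /=; rewrite SE.
Qed.
End linear_combination.

(** * The functional supporting the operator at a vector *)

Section inner_product.
Context {R : realType} {V : vectType R} (dot : {dot V for (idfun : R -> R)}).

Lemma dotC u v : dot u v = dot v u.
Proof. by rewrite hermC expr0 mul1r. Qed.

Lemma dotP a u v w : dot (a *: u + v) w = a * dot u w + dot v w.
Proof. by rewrite linearDl linearZl_LR. Qed.

Lemma dot_gt0 u : u != 0 -> 0 < dot u u.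
Proof. exact: neq0_dnorm_gt0. Qed.

Lemma dot_ge0 u : 0 <= dot u u.
Proof.
have [->|/dot_gt0/ltW//] := eqVneq u 0.
by rewrite linear0l.
Qed.

Lemma dot_CS u v : `|dot u v| <= dot_norm dot u * dot_norm dot v.
Proof.
rewrite -sqrtr_sqr /dot_norm -sqrtrM ?dot_ge0// ler_wsqrtr//.
exact: (psd_form_CS dotC dotP dot_ge0).
Qed.

Lemma dot_vecof (e : (\dim {:V}).-tuple V) x :
  dot (passmx.vecof e x) (passmx.vecof e x) = mx_form (gram_mx dot e) x x.
Proof.
rewrite mx_formE /passmx.vecof linear_sumr /=; apply: eq_bigr => j _.
rewrite linear_sumlz /= mulr_suml; apply: eq_bigr => i _.
by rewrite linearZ /= linearZl_LR /= mxE !(tnth_nth 0) mulrC.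
Qed.

Lemma gram_mx_sym (e : (\dim {:V}).-tuple V) : (gram_mx dot e)^T = gram_mx dot e.
Proof. by apply/matrixP => i j; rewrite !mxE dotC. Qed.

Lemma gram_mx_pos (e : (\dim {:V}).-tuple V) : basis_of fullv e ->
  forall x, x != 0 -> 0 < mx_form (gram_mx dot e) x x.
Proof. by move=> he x x0; rewrite -dot_vecof dot_gt0// passmx.vecof_eq0. Qed.

End inner_product.

Section coordinate_functional.
Context {R : realType} {S W : vectType R}.
Variables (dotS : {dot S for (idfun : R -> R)}) (dotW : {dot W for (idfun : R -> R)}).
Variables (e : (\dim {:S}).-tuple S) (he : basis_of fullv e) (O : 'Hom(S, W)).
Variable v : S.
Hypothesis Ov0 : O v != 0.

(** Coordinates of the functional xi |-> <u, O xi> where u is the unit vector in the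
    direction of O v: it is dominated by |O xi|, with equality at xi = v. *)
Definition support_coef j : R := dotW (O v) (O (tnth e j)) / dot_norm dotW (O v).

Let Ov_gt0 : 0 < dot_norm dotW (O v).
Proof. by rewrite sqrtr_gt0 dot_gt0. Qed.

Let v0 : v != 0.
Proof. by apply: contra Ov0 => /eqP ->; rewrite linear0. Qed.

Let dimS_gt0 : (0 < \dim {:S})%N.
Proof.
rewrite lt0n dimv_eq0; apply: contra v0 => /eqP f0.
by rewrite -memv0 -f0 memvf.
Qed.

Let support_coefE (x : 'rV[R]_(\dim {:S})) : \sum_j support_coef j * x 0 j =
  dotW (O v) (O (passmx.vecof e x)) / dot_norm dotW (O v).
Proof.
rewrite /passmx.vecof linear_sum linear_sumr mulr_suml; apply: eq_bigr => j _.
by rewrite /support_coef (tnth_nth 0) linearZ linearZ /=; ring.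
Qed.

Lemma support_functional_le (x : (\dim {:S}).-tuple R) :
  `|\sum_j support_coef j * tnth x j| <= dot_norm dotW (O (coord_inv e x)).
Proof.
have -> : \sum_j support_coef j * tnth x j =
    \sum_j support_coef j * (\row_j tnth x j) 0 j.
  by apply: eq_bigr => j _; rewrite mxE.
rewrite support_coefE normrM normfV (gtr0_norm Ov_gt0) ler_pdivrMr// mulrC.
exact: dot_CS.
Qed.

Lemma lambda_min_gram_gt0 : 0 < lambda_min (gram_mx dotS e).
Proof.
by apply: lambda_min_gt0; [exact: dimS_gt0|exact: gram_mx_sym|exact: gram_mx_pos].
Qed.

(** With x the coordinate vector of v, |O v| is the scalar product of the
    coefficients with x, so |O v| <= |coefficients| |x|, and the smallest
    eigenvalue of the Gram matrix gives lambda |x|^2 <= |v|^2. *)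
Lemma support_coef_ge :
  Num.sqrt (lambda_min (gram_mx dotS e)) * (dot_norm dotW (O v) / dot_norm dotS v) <=
  Num.sqrt (\sum_j support_coef j ^+ 2).
Proof.
set lam := lambda_min _.
have lam0 : 0 < lam by exact: lambda_min_gram_gt0.
have nv0 : 0 < dot_norm dotS v by rewrite sqrtr_gt0 dot_gt0.
pose x := passmx.rVof e v.
have xv : passmx.vecof e x = v by rewrite passmx.rVofK.
have ray : lam * sqnorm x <= dotS v v.
  rewrite -[in leRHS]xv dot_vecof; apply: lambda_min_le => //.
    exact: gram_mx_sym.
  exact: gram_mx_pos.
have hn : dot_norm dotW (O v) = \sum_j support_coef j * x 0 j.
  have sq : dotW (O v) (O v) = dot_norm dotW (O v) ^+ 2 by rewrite sqr_sqrtr ?dot_ge0.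
  by rewrite support_coefE xv sq expr2 mulfK// gt_eqF.
have CS : dot_norm dotW (O v) ^+ 2 <= (\sum_j support_coef j ^+ 2) * sqnorm x.
  pose u : 'rV[R]_(\dim {:S}) := \row_j support_coef j.
  have := psd_form_CS (fun u v => mx_formC u v (tr_scalar_mx _ 1))
    (@mx_formP _ _ 1%:M) _ u x.
  have -> : mx_form 1%:M u x = dot_norm dotW (O v).
    by rewrite hn /mx_form mulmx1 mxE; apply: eq_bigr => j _; rewrite !mxE.
  rewrite !mx_form1.
  have -> : sqnorm u = \sum_j support_coef j ^+ 2.
    by apply: eq_bigr => j _; rewrite mxE.
  by apply => w; rewrite mx_form1 sqnorm_ge0.
rewrite mulrA ler_pdivrMr// -ler_sqr ?nnegrE ?mulr_ge0 ?sqrtr_ge0//.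
have A0 : 0 <= \sum_j support_coef j ^+ 2 by apply: sumr_ge0 => j _; exact: sqr_ge0.
rewrite !exprMn (sqr_sqrtr (ltW lam0)) (sqr_sqrtr A0) (sqr_sqrtr (dot_ge0 dotS v)).
apply: (le_trans (ler_wpM2l (ltW lam0) CS)).
by rewrite mulrCA ler_wpM2l.
Qed.

End coordinate_functional.

(** * The randomized estimator *)

Section estimator.
Context {R : realType} {S W : vectType R}.
Variables (dotS : {dot S for (idfun : R -> R)}) (dotW : {dot W for (idfun : R -> R)}).
Variables (e : (\dim {:S}).-tuple S) (O : 'Hom(S, W)).
Context d (T : measurableType d) (P : probability T R).
Local Notation n := (\dim {:S}).

Let mtnth (r : {RV P >-> n.-tuple R}) j : measurable_fun setT (fun w => tnth (r w) j).
Proof. by apply: (measurableT_comp (measurable_tnth j)); exact: measurable_funP. Qed.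

Lemma measurable_dot_norm_coord_inv (r : {RV P >-> n.-tuple R}) :
  measurable_fun setT (fun w => dot_norm dotW (O (coord_inv e (r w)))).
Proof.
have msqrt : measurable_fun [set: R] (fun x : R => Num.sqrt x).
  by apply: continuous_measurable_fun; exact: sqrt_continuous.
apply: (measurableT_comp msqrt).
rewrite (_ : (fun _ => _) = fun w => \sum_(i < n) \sum_(j < n)
    dotW (O e`_i) (O e`_j) * (tnth (r w) i * tnth (r w) j)).
  apply: measurable_sum => i; apply: measurable_sum => j.
  by apply: measurable_funM => //; apply: measurable_funM; exact: mtnth.
apply/funext => w; rewrite /coord_inv /passmx.vecof linear_sum /= linear_sumlz.
apply: eq_bigr => i _; rewrite linear_sumr; apply: eq_bigr => j _.
by rewrite !linearZ /= linearZl_LR /= !mxE; ring.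
Qed.

Lemma measurable_Delta nt eps (r : 'I_nt -> {RV P >-> n.-tuple R}) :
  measurable_fun setT (Delta dotS dotW e O eps r).
Proof.
apply: measurable_funM => //.
elim: (index_enum _) => [|i s IH].
  by under eq_fun do rewrite big_nil; exact: measurable_cst.
under eq_fun do rewrite big_cons.
by apply: measurable_maxr => //; exact: measurable_dot_norm_coord_inv.
Qed.

Lemma powR_invnK nt (eps : R) : (0 < nt)%N -> 0 <= eps -> (eps `^ (nt%:R^-1)) ^+ nt = eps.
Proof.
move=> nt0 e0; rewrite -powR_mulrn ?powR_ge0// -powRrM mulVf ?powRr1//.
by rewrite pnatr_eq0 -lt0n.
Qed.

Lemma powR_invn_lt1 nt (eps : R) : (0 < nt)%N -> 0 < eps < 1 ->
  0 < eps `^ (nt%:R^-1) < 1.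
Proof.
move=> nt0 /andP[e0 e1]; rewrite powR_gt0//= ltNge; apply/negP => y1.
by have := exprn_ege1 nt y1; rewrite powR_invnK ?(ltW e0)// leNgt e1.
Qed.

Variables (nt : nat) (eps : R) (r : 'I_nt -> {RV P >-> n.-tuple R}).
Hypothesis nt_gt0 : (0 < nt)%N.
Hypothesis eps01 : 0 < eps < 1.
Hypothesis normal_r : forall i, random_normal_vector (r i).
Hypothesis indep_r : mutually_independent P (fun i w => r i w).
Hypothesis he : basis_of fullv e.

Let y := eps `^ (nt%:R^-1).
Let x := erf_inv y.

Let x_gt0 : 0 < x.
Proof. exact/erf_inv_gt0/powR_invn_lt1. Qed.

Lemma Delta_ge0 w : 0 <= Delta dotS dotW e O eps r w.
Proof.
rewrite mulr_ge0//; last by rewrite bigmax_idl le_max lexx.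
by rewrite invr_ge0 mulr_ge0 ?sqrtr_ge0 ?ltW.
Qed.

Let slab (a : 'I_n -> R) : set (n.-tuple R) :=
  [set t | `|\sum_j a j * tnth t j| <= Num.sqrt (\sum_j a j ^+ 2) * (Num.sqrt 2 * x)].

Let measurable_slab a : measurable (slab a).
Proof.
have mf : measurable_fun setT (fun t : n.-tuple R => `|\sum_j a j * tnth t j|).
  apply: measurableT_comp => //; apply: measurable_sum => j.
  by apply: measurable_funM => //; exact: measurable_tnth.
have := mf measurableT `]-oo, Num.sqrt (\sum_j a j ^+ 2) * (Num.sqrt 2 * x)]%classic.
move=> /(_ (measurable_itv _)); rewrite setTI.
by congr measurable; apply/seteqP; split => t /=; rewrite in_itv.
Qed.

(** The projection of a normal vector on the direction a is a standard normal
    variable times |a|, and erf_inv is chosen to make this probability equal to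
    the nt-th root of eps. *)
Lemma P_slab a i : 0 < Num.sqrt (\sum_j a j ^+ 2) -> P (r i @^-1` slab a) = y%:E.
Proof.
set s := Num.sqrt _ => s0; have [normal indep] := normal_r i.
pose B := `[- (s * (Num.sqrt 2 * x)), s * (Num.sqrt 2 * x)]%classic.
have -> : r i @^-1` slab a = [set w | B (\sum_j a j * tnth (r i w) j)].
  by apply/seteqP; split => w; rewrite /slab /B /= in_itv /= -ler_norml.
rewrite (law_linear_combination (mtnth (r i)) normal indep); last exact: measurable_itv.
have xy : erf x = y by exact/erf_invK/powR_invn_lt1.
rewrite -/s -[in RHS]xy -normal_prob_erf; last exact: ltW.
rewrite (_ : [set z | B (s * z)] = [set z | `|z| <= Num.sqrt 2 * x])//.
rewrite predeqE => z; rewrite /B /= in_itv /= -ler_norml normrM (gtr0_norm s0).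
by rewrite ler_pM2l.
Qed.

(** The estimator bounds a single quotient |O v| / |v|. If it fails, all the |O xi_i|
    are small, hence so are their images under the support functional of O v:
    all the vectors r i lie in one slab, and by independence this has
    probability (eps^(1/nt))^nt. *)
Lemma Delta_ge_quotient (v : S) : v != 0 ->
  (P [set w | (dot_norm dotW (O v) / dot_norm dotS v <= Delta dotS dotW e O eps r w)%R]
   >= (1 - eps)%:E)%E.
Proof.
move=> v0; have /andP[eps0 eps1] := eps01.
have [Ov0|Ov0] := eqVneq (O v) 0.
  rewrite (_ : [set w | _] = setT).
    by rewrite probability_setT lee_fin lerBlDr lerDl ltW.
  apply/seteqP; split => // w _ /=.
  by rewrite Ov0 /dot_norm linear0l sqrtr0 mul0r Delta_ge0.
set q := _ / _; set A := [set w | _].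
pose a := support_coef dotW e O v.
have lam0 := lambda_min_gram_gt0 dotS he Ov0.
have aq := support_coef_ge dotS dotW he Ov0.
rewrite -/a -/q in aq.
set lam := lambda_min _ in lam0 aq.
have q0 : 0 < q by rewrite divr_gt0 ?sqrtr_gt0 ?dot_gt0.
have sl0 : 0 < Num.sqrt lam by rewrite sqrtr_gt0.
have a0 : 0 < Num.sqrt (\sum_j a j ^+ 2) by apply: lt_le_trans aq; rewrite mulr_gt0.
have mA : measurable A.
  rewrite -[X in measurable X]setTI; apply: measurable_fun_le => //.
  exact: measurable_Delta.
have K0 : 0 < Num.sqrt (2 * lam) * x by rewrite mulr_gt0// sqrtr_gt0 mulr_gt0.
pose F := \bigcap_(i in [set` [set: 'I_nt]%SET]) r i @^-1` slab a.
have PF : P F = eps%:E.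
  rewrite /F (indep_r _ (fun=> measurable_slab a)).
  under eq_bigr do rewrite P_slab//.
  by rewrite prodEFin big_const cardsT card_ord iter_mulr_1 powR_invnK// ltW.
have mF : measurable F.
  apply: fin_bigcap_measurable => [|i _]; first exact: finite_finset.
  rewrite -[X in measurable X]setTI.
  by apply: (measurable_funP (r i) _ _ (measurable_slab a)).
have AF : ~` A `<=` F.
  move=> w /= /negP; rewrite -ltNge => Dq i _ /=.
  apply: (le_trans (support_functional_le dotW e Ov0 (r i w))).
  have : dot_norm dotW (O (coord_inv e (r i w))) <=
      \big[Num.max/0]_(i < nt) dot_norm dotW (O (coord_inv e (r i w))).
    exact: le_bigmax.
  move/le_trans; apply.
  have : \big[Num.max/0]_(i < nt) dot_norm dotW (O (coord_inv e (r i w))) <=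
      q * (Num.sqrt (2 * lam) * x).
    by move/ltW: Dq; rewrite /Delta /c_est -/lam -/y -/x mulrC ler_pdivrMr.
  move/le_trans; apply.
  rewrite sqrtrM//.
  have -> : q * (Num.sqrt 2 * Num.sqrt lam * x) = Num.sqrt lam * q * (Num.sqrt 2 * x).
    by ring.
  by rewrite ler_wpM2r// mulr_ge0// ltW.
rewrite -[A]setCK probability_setC; last exact: measurableC.
rewrite EFinB leeB// -PF; apply: le_measure; rewrite ?inE//; exact: measurableC.
Qed.

End estimator.

Unset Implicit Arguments.

Theorem proposition3p7 (R : realType) (S W : vectType R)
    (dotS : {dot S for (idfun : R -> R)}) (dotW : {dot W for (idfun : R -> R)})
    (e : (\dim {:S}).-tuple S) (he : basis_of fullv e)
    (O : 'Hom(S, W)) (nt : nat) (hnt : (1 <= nt)%N)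
    (eps : R) (heps0 : 0 < eps) (heps1 : eps < 1)
    (d : measure_display) (T : measurableType d) (P : probability T R)
    (r : 'I_nt -> {RV P >-> (\dim {:S}).-tuple R})
    (hnormal : forall i, random_normal_vector (r i))
    (hindep : mutually_independent P (fun i w => r i w)) :
  (P [set w | (op_norm dotS dotW O <= Delta dotS dotW e O eps r w)%R]
   >= (1 - eps)%:E)%E.
Proof.
have eps01 : 0 < eps < 1 by rewrite heps0.
rewrite /op_norm; set Q := [set _ | _ in _].
have [supQ|nsupQ] := pselect (has_sup Q); last first.
  (* The supremum over an empty or unbounded set is 0 by convention. *)
  rewrite sup_out// (_ : [set w | _] = setT).
    by rewrite probability_setT lee_fin lerBlDr lerDl ltW.
  by apply/seteqP; split => // w _ /=; exact: Delta_ge0.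
(* The event is the decreasing intersection of the events F k, each of which
   contains the event of [Delta_ge_quotient] for a nearly maximizing v. *)
pose F k := [set w | sup Q - k.+1%:R^-1 <= Delta dotS dotW e O eps r w].
have mge c : measurable [set w | c <= Delta dotS dotW e O eps r w].
  rewrite -[X in measurable X]setTI; apply: measurable_fun_le => //.
  exact: measurable_Delta.
have FE : [set w | sup Q <= Delta dotS dotW e O eps r w] = \bigcap_k F k.
  apply/seteqP; split => w /=.
    by move=> h k _; rewrite /F /=; apply: le_trans h; rewrite gerBl invr_ge0.
  move=> h; rewrite leNgt; apply/negP => /ltr_add_invr[k].
  by rewrite -ltrBrDr ltNge (h k).
have PF k : ((1 - eps)%:E <= P (F k))%E.
  have k0 : 0 < k.+1%:R^-1 :> R by rewrite invr_gt0.
  have [_ [v /= v0 <-] vsup] := sup_adherent k0 supQ.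
  apply: le_trans (Delta_ge_quotient dotS dotW O hnt eps01 hnormal hindep he v0) _.
  apply: le_measure; rewrite ?inE//; [exact: mge..|].
  by move=> w; apply: le_trans; exact: ltW.
rewrite FE.
have cvF : (P \o F) k @[k --> \oo] --> P (\bigcap_k F k).
  apply: nonincreasing_cvg_mu => //.
  - rewrite -ge0_fin_numE ?measure_ge0//; apply: fin_num_measure; exact: mge.
  - by move=> k; exact: mge.
  - by rewrite -FE.
  - move=> k l kl; apply/subsetPset => w; apply: le_trans.
    by rewrite lerB// lef_pV2 ?posrE// ler_nat ltnS.
rewrite -(cvg_lim _ cvF)//; apply: lime_ge; first by apply/cvg_ex; eexists; exact: cvF.
exact: nearW.
Qed.
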